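(* UQAFO is strictly more expressive than UNFOC: every UNFOC formula in one free variable is equivalent to a UQAFO formula, and there is a UQAFO formula in one free variable (over some schema) that is not equivalent to any UNFOC formula.
   Context: A schema $S$ is a finite set of relation symbols with arities $\ge 0$. An $S$-database $D$ is a finite set of facts $R(\bar v)$ over a fixed countably infinite set of values; $\mathrm{adom}(D)$ is the set of values occurring in $D$; a pointed database $D^v$ has $v\in\mathrm{adom}(D)$. Quantifiers range over $\mathrm{adom}(D)$. Formulas $\varphi(x),\psi(x)$ in one free variable are equivalent if $D\models\varphi(v)$ iff $D\models\psi(v)$ for all pointed $S$-databases $D^v$. UNFOC: $\varphi(\bar x)::=R(\bar x)\mid\varphi\wedge\varphi\mid\varphi\vee\varphi\mid\exists^{\ge n}y\,\varphi(\bar x,y)\mid\neg\varphi(x_i)$, $n\in\mathbb N$, where in the last clause $\varphi$ has no free variable besides possibly $x_i$ ($R(\bar x)$ is a relational atom; no equality atoms). UQAFO: with $\circ\in\{\vee,\wedge\}$, $\varphi(\bar x)::=\varphi_\exists(\bar x)\mid\varphi_\forall(\bar x)\mid\varphi(\bar x)\circ\varphi(\bar x)$; $\varphi_\exists(\bar x)::=R(\bar x)\mid\neg R(\bar x)\mid\varphi_\exists(\bar x)\circ\varphi_\exists(\bar x)\mid x_i=x_j\mid x_i\ne x_j\mid\exists\bar y\,\varphi_\exists(\bar x,\bar y)\mid\varphi_\forall(x_i)$; $\varphi_\forall(\bar x)::=R(\bar x)\mid\neg R(\bar x)\mid\varphi_\forall(\bar x)\circ\varphi_\forall(\bar x)\mid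 x_i=x_j\mid x_i\ne x_j\mid\forall\bar y\,\varphi_\forall(\bar x,\bar y)\mid\varphi_\exists(x_i)$ (in the last alternatives of the last two rules the formula has at most the free variable $x_i$). *)

(* Defs.v *)
From mathcomp Require Import all_boot finmap.

Set Implicit Arguments.
Unset Strict Implicit.
Unset Printing Implicit Defensive.

Record schema := Schema { rel_symb : finType; arity : rel_symb -> nat }.

Definition value := nat.
Definition var := nat.

Definition fact (S : schema) := {R : rel_symb S & (arity R).-tuple value}.

Definition database (S : schema) := {fset (fact S)}.

Definition adom (S : schema) (D : database S) : {fset value} :=
  [fset v in flatten [seq val (tagged f) | f : fact S <- D]]%fset.

(* A common syntax for both logics, which are carved out of it below. *)
Inductive formula (S : schema) : Type :=
| Atom (R : rel_symb S) of (arity R).-tuple var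
| Eq of var & var
| Not of formula S
| And of formula S & formula S
| Or of formula S & formula S
| Ex of var & formula S
| All of var & formula S
| ExGe of nat & var & formula S.

Arguments Atom {S}.
Arguments Eq {S}.

Fixpoint fv (S : schema) (phi : formula S) : seq var :=
  match phi with
  | Atom _ t => t
  | Eq x y => [:: x; y]
  | Not phi => fv phi
  | And phi psi | Or phi psi => fv phi ++ fv psi
  | Ex y phi | All y phi | ExGe _ y phi => [seq z <- fv phi | z != y]
  end.

(* As in the notation phi(x), x need not actually occur in phi. *)
Definition free_only (S : schema) (x : var) (phi : formula S) : Prop :=
  {subset fv phi <= [:: x]}.

Fixpoint sat (S : schema) (D : database S) (e : var -> value)
    (phi : formula S) : bool :=
  match phi with
  | Atom R t => (Tagged (fun R => (arity R).-tuple value) (map_tuple e t)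
                   : fact S) \in D
  | Eq x y => e x == e y
  | Not phi => ~~ sat D e phi
  | And phi psi => sat D e phi && sat D e psi
  | Or phi psi => sat D e phi || sat D e psi
  | Ex y phi => has (fun v => sat D [eta e with y |-> v] phi) (adom D)
  | All y phi => all (fun v => sat D [eta e with y |-> v] phi) (adom D)
  | ExGe n y phi =>
      n <= #|` [fset v in adom D | sat D [eta e with y |-> v] phi]%fset |
  end.

(* D |= phi(v) for phi with at most one free variable: only the value assigned
   to that variable matters, so the constant assignment v can be used. *)
Definition models (S : schema) (D : database S) (v : value)
    (phi : formula S) : bool :=
  sat D (fun=> v) phi.

Definition equivalent (S : schema) (phi psi : formula S) : Prop :=
  forall (D : database S) (v : value), v \in adom D ->
    models D v phi <-> models D v psi.

Inductive unfoc (S : schema) : formula S -> Prop :=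
| unfoc_atom R t : unfoc (Atom R t)
| unfoc_and phi psi : unfoc phi -> unfoc psi -> unfoc (And phi psi)
| unfoc_or phi psi : unfoc phi -> unfoc psi -> unfoc (Or phi psi)
| unfoc_exge n y phi : unfoc phi -> unfoc (ExGe n y phi)
| unfoc_not x phi : free_only x phi -> unfoc phi -> unfoc (Not phi).

(* Quantifier blocks over tuples of variables are iterated quantifiers. *)
Inductive uqafo_ex (S : schema) : formula S -> Prop :=
| uqafo_ex_atom R t : uqafo_ex (Atom R t)
| uqafo_ex_natom R t : uqafo_ex (Not (Atom R t))
| uqafo_ex_and phi psi : uqafo_ex phi -> uqafo_ex psi -> uqafo_ex (And phi psi)
| uqafo_ex_or phi psi : uqafo_ex phi -> uqafo_ex psi -> uqafo_ex (Or phi psi)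
| uqafo_ex_eq x y : uqafo_ex (Eq x y)
| uqafo_ex_neq x y : uqafo_ex (Not (Eq x y))
| uqafo_ex_quant y phi : uqafo_ex phi -> uqafo_ex (Ex y phi)
| uqafo_ex_alt x phi : free_only x phi -> uqafo_all phi -> uqafo_ex phi
with uqafo_all (S : schema) : formula S -> Prop :=
| uqafo_all_atom R t : uqafo_all (Atom R t)
| uqafo_all_natom R t : uqafo_all (Not (Atom R t))
| uqafo_all_and phi psi :
    uqafo_all phi -> uqafo_all psi -> uqafo_all (And phi psi)
| uqafo_all_or phi psi :
    uqafo_all phi -> uqafo_all psi -> uqafo_all (Or phi psi)
| uqafo_all_eq x y : uqafo_all (Eq x y)
| uqafo_all_neq x y : uqafo_all (Not (Eq x y))
| uqafo_all_quant y phi : uqafo_all phi -> uqafo_all (All y phi)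
| uqafo_all_alt x phi : free_only x phi -> uqafo_ex phi -> uqafo_all phi.

Inductive uqafo (S : schema) : formula S -> Prop :=
| uqafo_of_ex phi : uqafo_ex phi -> uqafo phi
| uqafo_of_all phi : uqafo_all phi -> uqafo phi
| uqafo_and phi psi : uqafo phi -> uqafo psi -> uqafo (And phi psi)
| uqafo_or phi psi : uqafo phi -> uqafo psi -> uqafo (Or phi psi).

(* Main.v *)
Require Import Defs.
From mathcomp Require Import all_boot finmap.

(** UNFOC into UQAFO: [ExGe n y phi] becomes a block of existential quantifiers
    over pairwise distinct fresh variables z, with [phi(z)] written as
    [exists y, y = z /\ phi(y)] so that no substitution is needed, and negations
    are pushed inwards, which swaps the two fragments of UQAFO.

    Strictness: the witness is [exists y, ~ R(x,y)].  Given a UNFOC formula whose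
    counting thresholds are at most N, take the complete reflexive digraph on
    {0, ..., N+2} without the edge (0,1).  The values other than 0 and 1 are
    related to everything, so there are always N harmless witnesses and, as long
    as 0 and 1 are not both assigned, the formula takes the truth value it has on
    a complete digraph.  Negation never sees both 0 and 1, being unary.  Hence the
    formula does not separate 0 from 2, but the witness does. *)

Set Implicit Arguments.
Unset Strict Implicit.
Unset Printing Implicit Defensive.

(* [inE] would also unfold [A] when it is an [adom]. *)
Lemma in_fset_sep (A : {fset value}) (P : pred value) v :
  (v \in [fset w in A | P w]%fset) = (v \in A) && P v.
Proof. by rewrite !inE. Qed.

(** * Translation of UNFOC into UQAFO *)

Section UnfocToUqafo.
Variable S : schema.
Implicit Types (phi psi : formula S) (D : database S) (e : var -> value).

Lemma eq_in_sat D e1 e2 phi :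
  {in fv phi, e1 =1 e2} -> sat D e1 phi = sat D e2 phi.
Proof.
elim: phi e1 e2 => [R t|x y|phi IH|phi IH1 psi IH2|phi IH1 psi IH2|y phi IH
    |y phi IH|n y phi IH] e1 e2 /= He.
- by congr (Tagged _ _ \in D); apply/val_inj/eq_in_map.
- by rewrite !He ?inE ?eqxx ?orbT.
- by rewrite (IH e1 e2).
- by rewrite (IH1 e1 e2) ?(IH2 e1 e2) // => z Hz;
    apply: He; rewrite mem_cat Hz ?orbT.
- by rewrite (IH1 e1 e2) ?(IH2 e1 e2) // => z Hz;
    apply: He; rewrite mem_cat Hz ?orbT.
- apply: eq_has => v; apply: IH => z Hz /=.
  by case: eqP => // /eqP zy; apply: He; rewrite mem_filter zy.
- apply: eq_all => v; apply: IH => z Hz /=.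
  by case: eqP => // /eqP zy; apply: He; rewrite mem_filter zy.
- congr (_ <= #|` _|)%N; apply/fsetP => v; rewrite !inE /=; congr (_ && _).
  apply: IH => z Hz /=.
  by case: eqP => // /eqP zy; apply: He; rewrite mem_filter zy.
Qed.

(** The default case negates [ExGe] outright, so [sat_dual] holds for every formula; on UQAFO
    formulas, [Not] is put only on atoms and equalities. *)
Fixpoint dual phi : formula S :=
  match phi with
  | Not phi => phi
  | And phi psi => Or (dual phi) (dual psi)
  | Or phi psi => And (dual phi) (dual psi)
  | Ex y phi => All y (dual phi)
  | All y phi => Ex y (dual phi)
  | _ => Not phi
  end.

Lemma fv_dual phi : fv (dual phi) = fv phi.
Proof. by elim: phi => //= [p -> q ->|p -> q ->|y p ->|y p ->]. Qed.

Lemma sat_dual D e phi : sat D e (dual phi) = ~~ sat D e phi.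
Proof.
elim: phi e => //= [p _|p IHp q IHq|p IHp q IHq|y p IH|y p IH] e.
- by rewrite negbK.
- by rewrite IHp IHq negb_and.
- by rewrite IHp IHq negb_or.
- by rewrite -all_predC; apply: eq_all => v; rewrite IH.
- by rewrite -has_predC; apply: eq_has => v; rewrite IH.
Qed.

Scheme uqafo_ex_mut := Minimality for uqafo_ex Sort Prop
with uqafo_all_mut := Minimality for uqafo_all Sort Prop.

(** Mutual induction, as alternation rules switch fragments; their side condition survives by
    [fv_dual]. *)
Lemma uqafo_all_dual phi : uqafo_ex phi -> uqafo_all (dual phi).
Proof.
apply: (@uqafo_ex_mut S (fun p => uqafo_all (dual p))
  (fun p => uqafo_ex (dual p))) => /=; intros; try by constructor.
- by apply: (@uqafo_all_alt _ x); rewrite /free_only ?fv_dual.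
- by apply: (@uqafo_ex_alt _ x); rewrite /free_only ?fv_dual.
Qed.

(** Closed, hence harmless for free variables, and universal, hence true even over an empty
    domain. *)
Definition verum : formula S := All 0 (Eq 0 0).

Lemma uqafo_ex_verum : uqafo_ex verum.
Proof. by apply: (@uqafo_ex_alt _ 0) => //; do 2!constructor. Qed.

Lemma sat_verum D e : sat D e verum.
Proof. by apply/allP => v _ /=. Qed.

Definition differs z (zs : seq var) : formula S :=
  foldr (fun w => And (Not (Eq z w))) verum zs.

Lemma uqafo_ex_differs z zs : uqafo_ex (differs z zs).
Proof.
elim: zs => [|w zs IH]; first exact: uqafo_ex_verum.
by do 2?constructor.
Qed.

Lemma fv_differs z zs : {subset fv (differs z zs) <= z :: zs}.
Proof.
elim: zs => [|w zs IH] u //=; rewrite !inE => /or3P[->|->|/IH] //.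
  by rewrite orbT.
by rewrite inE => /orP[|] ->; rewrite ?orbT.
Qed.

Lemma sat_differs D e z zs : sat D e (differs z zs) = (e z \notin map e zs).
Proof.
elim: zs => [|w zs IH]; first by rewrite sat_verum.
by rewrite /= IH inE negb_or.
Qed.

Definition fresh (s : seq var) : var := (\max_(z <- s) z).+1.

Lemma fresh_notin s : fresh s \notin s.
Proof.
apply/negP => H; have := @leq_bigmax_seq _ s xpredT id _ H isT.
by rewrite ltnn.
Qed.

(** [zs] lists the variables of the witnesses already chosen. The fresh one must avoid [zs] to keep
    their values, [fv phi] to leave [phi] unaffected, and [y], which is rebound when [phi] is
    evaluated at [z]. *)
Fixpoint at_least n y phi (zs : seq var) : formula S :=
  if n is n'.+1 then
    let z := fresh (y :: fv phi ++ zs) in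
    Ex z (And (And (differs z zs) (Ex y (And (Eq y z) phi)))
              (at_least n' y phi (z :: zs)))
  else verum.

Lemma uqafo_ex_at_least n y phi zs :
  uqafo_ex phi -> uqafo_ex (at_least n y phi zs).
Proof.
move=> Hphi; elim: n zs => [|n IH] zs; first exact: uqafo_ex_verum.
constructor; apply: uqafo_ex_and (IH _).
apply: uqafo_ex_and (uqafo_ex_differs _ _) _.
by do 2!constructor=> //; constructor.
Qed.

Lemma fv_at_least n y phi zs :
  {subset fv (at_least n y phi zs) <= [seq z <- fv phi | z != y] ++ zs}.
Proof.
elim: n zs => [|n IH] zs u //=.
rewrite mem_filter => /andP[uz].
rewrite !mem_cat => /orP[/orP[/fv_differs|]|/IH].
- by rewrite inE (negbTE uz) /= => ->; rewrite orbT.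
- by rewrite eqxx; case: ifP => _; rewrite ?inE ?(negbTE uz) /= => ->.
- by rewrite mem_cat inE (negbTE uz).
Qed.

(** The counting behind one unfolding of [at_least]: pick a witness, then count the remaining
    ones. *)
Lemma cardfs_gtP (X : {fset value}) n :
  reflect (exists2 v, v \in X & n <= #|` (X `\ v)%fset|)%N (n < #|` X|)%N.
Proof.
apply: (iffP idP) => [nX|[v vX]]; last by rewrite (cardfsD1 v X) vX.
have /fset0Pn[v vX] : X != fset0 by rewrite -cardfs_gt0; apply: leq_trans nX.
by exists v => //; move: nX; rewrite (cardfsD1 v X) vX.
Qed.

Lemma sat_at_least D e n y phi zs :
  sat D e (at_least n y phi zs) =
  (n <= #|` [fset v in adom D |
      sat D [eta e with y |-> v] phi && (v \notin map e zs)]%fset|)%N.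
Proof.
elim: n e zs => [|n IH] e zs; first exact: sat_verum.
set z := fresh (y :: fv phi ++ zs); set X := [fset v in _ | _]%fset.
have XE w : (w \in X) = [&& w \in adom D, sat D [eta e with y |-> w] phi &
    w \notin map e zs] by rewrite in_fset_sep.
have := fresh_notin (y :: fv phi ++ zs); rewrite -/z inE mem_cat !negb_or.
case/and3P => zy zphi zzs.
have map_zs v : map [eta e with z |-> v] zs = map e zs.
  apply/eq_in_map => w wzs /=; case: eqP => // wz.
  by rewrite -wz wzs in zzs.
have sat_phi v w :
    sat D [eta [eta e with z |-> v] with y |-> w] phi =
    sat D [eta e with y |-> w] phi.
  apply: eq_in_sat => u uphi /=; case: (u == y) => //; case: eqP => // uz.
  by rewrite -uz uphi in zphi.
have pick v : v \in adom D ->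
    sat D [eta e with z |-> v] (Ex y (And (Eq y z) phi)) =
    sat D [eta e with y |-> v] phi.
  move=> vD /=; apply/hasP/idP => [[w _]|Hv]; last exists v => //.
    by rewrite /= !eqxx (negbTE zy) => /andP[/eqP ->]; rewrite sat_phi.
  by rewrite /= !eqxx (negbTE zy) sat_phi eqxx.
(* Adding [z] to the excluded variables removes exactly its value [v] from the candidates. *)
have rest v :
    sat D [eta e with z |-> v] (at_least n y phi (z :: zs)) =
    (n <= #|` (X `\ v)%fset|)%N.
  rewrite IH; set m := map _ (z :: zs).
  have mE w : (w \in m) = (w == v) || (w \in map e zs).
    by rewrite /m map_cons in_cons map_zs /= eqxx.
  clearbody m.
  congr (_ <= #|` _|)%N; apply/fsetP => w; rewrite !inE /= sat_phi mE negb_or.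
  by case: (w == v); rewrite /= ?andbF ?andbT.
have body v : v \in adom D ->
    sat D [eta e with z |-> v] (And (And (differs z zs)
      (Ex y (And (Eq y z) phi))) (at_least n y phi (z :: zs))) =
    (v \in X) && (n <= #|` (X `\ v)%fset|)%N.
  have sat_and e' p q : sat D e' (And p q) = sat D e' p && sat D e' q by [].
  move=> vD; rewrite -rest !sat_and pick // sat_differs map_zs /= eqxx.
  by rewrite XE vD /= [in RHS](andbC (sat D _ phi)).
transitivity (has (fun v => (v \in X) && (n <= #|` (X `\ v)%fset|)%N) (adom D)).
  exact: eq_in_has.
apply/hasP/cardfs_gtP => -[v]; first by move=> _ /andP[]; exists v.
by move=> vX Hn; exists v; rewrite ?vX //; move: vX; rewrite XE => /andP[].
Qed.

(** Everything lands in the existential fragment: duality sends a negation to the universal one, and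
    alternation leads back because at most one variable is free. Hence the bound on [fv psi] in the
    induction. *)
Lemma unfoc_uqafo_ex phi : unfoc phi -> exists psi,
  [/\ uqafo_ex psi, {subset fv psi <= fv phi} &
      forall D e, sat D e psi = sat D e phi].
Proof.
elim=> {phi} [R t|p q _ [p' [Hp fp sp]] _ [q' [Hq fq sq]]
    |p q _ [p' [Hp fp sp]] _ [q' [Hq fq sq]]|n y p _ [p' [Hp fp sp]]
    |x p px _ [p' [Hp fp sp]]].
- by exists (Atom R t); split=> //; constructor.
- exists (And p' q'); split=> [|z|D e] /=; first by constructor.
    by rewrite !mem_cat => /orP[/fp|/fq] ->; rewrite ?orbT.
  by rewrite sp sq.
- exists (Or p' q'); split=> [|z|D e] /=; first by constructor.
    by rewrite !mem_cat => /orP[/fp|/fq] ->; rewrite ?orbT.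
  by rewrite sp sq.
- exists (at_least n y p' [::]); split=> [|z /fv_at_least|D e].
  + exact: uqafo_ex_at_least.
  + by rewrite cats0 /= !mem_filter => /andP[-> /fp].
  + rewrite sat_at_least /=; congr (_ <= #|` _|)%N.
    by apply/fsetP => v; rewrite !inE /= sp andbT.
- exists (dual p'); split=> [|z|D e] /=; last by rewrite sat_dual sp.
    apply: (@uqafo_ex_alt _ x); last exact: uqafo_all_dual.
    by move=> z; rewrite fv_dual => /fp/px.
  by rewrite fv_dual => /fp.
Qed.

End UnfocToUqafo.

(** * The digraph with one missing edge *)

Definition digraph_schema : schema := @Schema unit (fun=> 2).

Definition edge (i j : value) : fact digraph_schema :=
  Tagged (fun R => (@arity digraph_schema R).-tuple value) (i := tt)
    [tuple i; j].

Definition witness : formula digraph_schema :=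
  Ex 1 (Not (@Atom digraph_schema tt [tuple 0; 1])).

Definition punctured (N : nat) : database digraph_schema :=
  [fset f in [seq edge p.1 p.2 | p <- [seq (i, j) | i <- iota 0 N.+3,
     j <- iota 0 N.+3] & p != (0, 1)]]%fset.

Lemma edge_inj i j k l : edge i j = edge k l -> (i, j) = (k, l).
Proof. by move/eqP; rewrite eq_Tagged /= => /eqP[-> ->]. Qed.

Lemma edge_punctured N i j :
  (edge i j \in punctured N) =
  [&& (i < N.+3), (j < N.+3) & (i, j) != (0, 1)]%N.
Proof.
have -> : (edge i j \in punctured N) = (edge i j \in [seq edge p.1 p.2 | p <-
   [seq (i, j) | i <- iota 0 N.+3, j <- iota 0 N.+3] & p != (0, 1)]).
  by rewrite in_fset.
apply/mapP/and3P => [[[k l]]|[iN jN ij]].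
  rewrite mem_filter => /andP[kl /allpairsP[[k' l'] [kN lN [ek el]]]].
  move/edge_inj=> [-> ->]; rewrite ek el /= in kl *.
  by rewrite !mem_iota /= in kN lN; split.
exists (i, j) => //; rewrite mem_filter ij; apply/allpairsP; exists (i, j).
by rewrite !mem_iota.
Qed.

Lemma adom_punctured N v : (v \in adom (punctured N)) = (v < N.+3)%N.
Proof.
have -> : (v \in adom (punctured N)) =
    (v \in flatten [seq val (tagged f) | f : fact digraph_schema
       <- (punctured N : {fset _})]).
  by rewrite in_fset.
apply/flattenP/idP => [[s /mapP[[[] t] ft ->]]|vN].
  case: t ft => [[|i [|j []]]] // t ft.
  have : edge i j \in punctured N.
    rewrite (_ : edge i j = Tagged _ (Tuple t)) //.
    by congr Tagged; apply: val_inj.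
  by rewrite edge_punctured !inE => /and3P[iN jN _] /orP[]/eqP->.
(* All loops are kept, so each vertex occurs in a fact. *)
exists [:: v; v]; last by rewrite inE eqxx.
apply/mapP; exists (edge v v) => //.
by rewrite edge_punctured vN; case: v vN.
Qed.

(** * UNFOC on the punctured digraph *)

Fixpoint threshold S (phi : formula S) : nat :=
  match phi with
  | Atom _ _ | Eq _ _ => 0
  | Not phi | Ex _ phi | All _ phi => threshold phi
  | And phi psi | Or phi psi => maxn (threshold phi) (threshold psi)
  | ExGe n _ phi => maxn n (threshold phi)
  end.

(* Junk value [true] on [Eq], [Ex] and [All], which do not occur in UNFOC. *)
Fixpoint truth_on_complete S (phi : formula S) : bool :=
  match phi with
  | And phi psi => truth_on_complete phi && truth_on_complete psi
  | Or phi psi => truth_on_complete phi || truth_on_complete psi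
  | Not phi => ~~ truth_on_complete phi
  | ExGe n _ phi => (n == 0) || truth_on_complete phi
  | _ => true
  end.

(** Losing an edge can only falsify a positive formula, so only the converse needs a condition on
    the assignment. Under a negation that condition is automatic, so the two directions can be
    exchanged. *)
Lemma sat_punctured N (phi : formula digraph_schema) (e : var -> value) :
  unfoc phi -> (threshold phi <= N)%N -> (forall x, e x < N.+3)%N ->
  (sat (punctured N) e phi -> truth_on_complete phi) /\
  ({in fv phi &, forall x y, (e x, e y) != (0, 1)} ->
   truth_on_complete phi -> sat (punctured N) e phi).
Proof.
move=> Hphi; elim: Hphi e => {phi} [[] t|p q _ IHp _ IHq|p q _ IHp _ IHq
    |n y p _ IH|x p px _ IH] e /=.
- move=> _ eN; split=> // He _.
  case: t He => [[|i [|j []]]] // t He.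
  have -> : map_tuple e (Tuple t) = [tuple e i; e j] by apply: val_inj.
  by rewrite [_ \in _](edge_punctured N (e i) (e j)) !eN He ?inE ?eqxx ?orbT.
- rewrite geq_max => /andP[pN qN] eN.
  have [p1 p2] := IHp e pN eN; have [q1 q2] := IHq e qN eN.
  split=> [/andP[/p1 -> /q1 ->] //|He /andP[tp tq]].
  by rewrite p2 // ?q2 // => u v Hu Hv; apply: He;
    rewrite mem_cat ?Hu ?Hv ?orbT.
- rewrite geq_max => /andP[pN qN] eN.
  have [p1 p2] := IHp e pN eN; have [q1 q2] := IHq e qN eN.
  split=> [/orP[/p1|/q1] -> //|He /orP[tp|tq]]; first by rewrite orbT.
    by rewrite p2 // => u v Hu Hv; apply: He; rewrite mem_cat ?Hu ?Hv ?orbT.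
  by rewrite q2 ?orbT // => u v Hu Hv; apply: He; rewrite mem_cat ?Hu ?Hv ?orbT.
- rewrite geq_max => /andP[nN pN] eN.
  have upd_lt v : (v < N.+3)%N -> forall z, ([eta e with y |-> v] z < N.+3)%N.
    by move=> vN z /=; case: (z == y).
  split=> [|He /orP[/eqP -> //|tp]].
    (* For positive [n], a single witness yields the truth of [p] on the complete digraph, which
       does not depend on the assignment. *)
    case: n {nN} => // n /cardfs_gtP[v]; rewrite in_fset_sep adom_punctured.
    by case/andP => vN /(proj1 (IH _ pN (upd_lt v vN))).
  (* The [N] values 2, ..., N+1 all serve as witnesses. *)
  apply: (leq_trans nN); rewrite -[N in (N <= _)%N](size_iota 2).
  rewrite -(undup_id (iota_uniq 2 N)) -card_fseq.
  apply/fsubset_leq_card/fsubsetP => v; rewrite in_fset mem_iota.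
  case/andP => v2 vN; rewrite add2n in vN.
  have vN3 : (v < N.+3)%N by apply: ltnW.
  rewrite in_fset_sep adom_punctured vN3 /=.
  apply: (proj2 (IH _ pN (upd_lt v vN3))) tp => u w Hu Hw /=.
  (* The value of [y] is at least 2, so a pair involving [y] is not the missing edge. *)
  case: (eqVneq u y) => [_|uy].
    by apply/negP=> /eqP[v0 _]; rewrite v0 in v2.
  case: (eqVneq w y) => [_|wy].
    by apply/negP=> /eqP[_ v1]; rewrite v1 in v2.
  by apply: He; rewrite mem_filter ?uy ?wy.
- move=> pN eN; have [p1 p2] := IH e pN eN.
  (* Both variables are [x], whose value cannot be 0 and 1 at once. *)
  have He : {in fv p &, forall u v, (e u, e v) != (0, 1)}.
    move=> u v /px; rewrite inE => /eqP -> /px; rewrite inE => /eqP ->.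
    by apply/negP=> /eqP[->].
  by split=> [|_]; apply: contra; [exact: p2 | exact: p1].
Qed.

Theorem lemma11 :
  (forall (S : schema) (x : var) (phi : formula S),
     unfoc phi -> free_only x phi ->
     exists psi : formula S,
       [/\ uqafo psi, free_only x psi & equivalent phi psi])
  /\
  (exists (S : schema) (x : var) (psi : formula S),
     [/\ uqafo psi, free_only x psi &
         forall phi : formula S,
           unfoc phi -> free_only x phi -> ~ equivalent phi psi]).
Proof.
split=> [S x phi Hphi xphi|].
  have [psi [Hpsi fpsi spsi]] := unfoc_uqafo_ex Hphi.
  exists psi; split; first exact: uqafo_of_ex.
    by move=> z /fpsi/xphi.
  by move=> D v _; rewrite /models spsi.
exists digraph_schema, 0, witness; split=> [|//|phi Hphi xphi equiv].
  by do 3!constructor.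
pose N := threshold phi.
have models_phi v : (v < N.+3)%N ->
    models (punctured N) v phi = truth_on_complete phi.
  move=> vN; have [H1 H2] := sat_punctured Hphi (leqnn N) (fun=> vN).
  by apply/idP/idP => // /H2; apply=> u w _ _; apply/negP=> /eqP[->].
have models_witness v : (v < N.+3)%N ->
    models (punctured N) v witness = (v == 0).
  move=> vN; transitivity (has (fun w => edge v w \notin punctured N)
      (adom (punctured N))).
    apply: eq_has => w; congr (~~ in_mem _ _); congr Tagged.
    exact: val_inj.
  apply/hasP/eqP => [[w]|->].
    rewrite adom_punctured edge_punctured => wN.
    by rewrite vN wN /= negbK => /eqP[].
  by exists 1; rewrite ?adom_punctured // edge_punctured eqxx !andbF.
(* [phi] has the same truth value at 0 and 2, while [witness] holds at 0 only. *)
have := equiv (punctured N) 0; have := equiv (punctured N) 2.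
rewrite !adom_punctured !models_phi // !models_witness //=.
by move=> /(_ isT)[H _] /(_ isT)[_ /(_ isT)/H].
Qed.
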